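(* Let $d\geq 2$. There are infinitely many number fields $K$ of degree $d$ with $\mathrm{od}(K)=\infty$.
   Context: For a number field $K$, ''units'' means units of its ring of integers. $\mathrm{od}(K)$ is the smallest odd $k\geq 3$ such that there exist units $\varepsilon_1,\dots,\varepsilon_k$ of $K$ with $\varepsilon_1+\dots+\varepsilon_k=0$, and $\mathrm{od}(K)=\infty$ if no such odd $k$ exists. *)

(* Defs.v *)
From HB Require Import structures.
From mathcomp Require Import all_boot all_order all_algebra all_field.
From mathcomp Require Import boolp.

Set Implicit Arguments.
Unset Strict Implicit.
Unset Printing Implicit Defensive.

Import GRing.Theory.
Local Open Scope ring_scope.

(* A number field is a [K : fieldExtType rat]: such a K is finite dimensional
   over rat by construction, and its degree is [\dim {:K}]. *)

Definition ring_of_integers (K : fieldExtType rat) (x : K) : Prop :=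
  integralOver (intr : int -> K) x.

Definition integer_unit (K : fieldExtType rat) (x : K) : Prop :=
  ring_of_integers x /\ exists2 y : K, ring_of_integers y & x * y = 1.

Definition odd_unit_sum (K : fieldExtType rat) (k : nat) : Prop :=
  [/\ odd k, (3 <= k)%N
    & exists e : 'I_k -> K,
        (forall i, integer_unit (e i)) /\ \sum_(i < k) e i = 0].

Lemma odd_unit_sum_asbool (K : fieldExtType rat) :
  (exists k, odd_unit_sum K k) -> exists k, `[< odd_unit_sum K k >].
Proof. by case=> k Hk; exists k; apply/asboolP. Qed.

(* [None] stands for the value infinity. *)
Definition od (K : fieldExtType rat) : option nat :=
  match pselect (exists k, odd_unit_sum K k) with
  | left ex => Some (ex_minn (odd_unit_sum_asbool ex))
  | right _ => None
  end.

(* Ring isomorphism; it is automatically rat-linear in characteristic 0. *)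
Definition field_isomorphic (K L : fieldExtType rat) : Prop :=
  exists f : {rmorphism K -> L}, bijective f.

(* Main.v *)
(* K_n = Q(z) with z^d = 2p, for distinct odd primes p = p_n > d.  The prime 2
   is totally ramified in K_n, with residue field F_2, so every unit reduces to 1
   in F_2 and an odd number of units cannot sum to 0.  This is made explicit on
   fractions A(z)/N with A in Z[X] and N odd: every integer of K_n is of that
   form, and A(0) mod 2 is its residue.  The fields are pairwise non-isomorphic
   because K_q contains no d-th root of 2p for p prime to 2dq: X^d - 2q is
   separable mod p, so p is unramified in K_q. *)
Require Import Defs.
From HB Require Import structures.
From mathcomp Require Import all_boot all_order all_algebra all_field.
From mathcomp Require Import boolp.
From mathcomp Require Import ring zify.

Set Implicit Arguments.
Unset Strict Implicit.
Unset Printing Implicit Defensive.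

Import GRing.Theory.
Local Open Scope ring_scope.

(** * Elements of K as fractions A(z)/N with A in Z[X] *)

Definition zeval (K : fieldExtType rat) (z : K) : {rmorphism {poly int} -> K} :=
  horner_eval z \o map_poly intr.
Arguments zeval {K} z : simpl never.

Lemma zevalE (K : fieldExtType rat) (z : K) (A : {poly int}) :
  zeval z A = (map_poly intr A).[z].
Proof. by []. Qed.

Lemma zevalC (K : fieldExtType rat) (z : K) (c : int) : zeval z c%:P = c%:~R.
Proof. by rewrite zevalE map_polyC hornerC. Qed.

Lemma zevalCn (K : fieldExtType rat) (z : K) (n : nat) : zeval z n%:Z%:P = n%:R.
Proof. exact: zevalC. Qed.

Lemma zevalX (K : fieldExtType rat) (z : K) : zeval z 'X = z.
Proof. by rewrite zevalE map_polyX hornerX. Qed.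

Lemma map_poly_intr_alg (K : fieldExtType rat) (A : {poly int}) :
  map_poly (intr : int -> K) A = map_poly (in_alg K) (map_poly intr A).
Proof.
rewrite -map_poly_comp; apply: eq_map_poly => c.
exact/esym/(rmorph_int (in_alg K)).
Qed.

Lemma intr_ext_eq0 (K : fieldExtType rat) (c : int) : (c%:~R == 0 :> K) = (c == 0).
Proof. by rewrite -(rmorph_int (in_alg K)) fmorph_eq0 intr_eq0. Qed.

(** Since f is monic, division stays in Z[X]. By Gauss f is irreducible over Q, so a nonzero
    remainder, having smaller degree, would be coprime to f over Q. Coprimality survives in K, where
    the two would share the root z. *)
Lemma zeval_eq0_dvd (K : fieldExtType rat) (z : K) (f A : {poly int}) :
    f \is monic -> irreducible_poly f -> zeval z f = 0 -> zeval z A = 0 ->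
  exists Q, A = Q * f.
Proof.
move=> fM f_irr fz0 Az0.
have defA := Pdiv.RingMonic.rdivp_eq fM A.
set r := Pdiv.CommonRing.rmodp A f in defA.
have rz0 : zeval z r = 0.
  by move: Az0; rewrite defA rmorphD rmorphM [zeval z f]fz0 mulr0 add0r.
have [r0|r_neq0] := eqVneq r 0.
  by exists (Pdiv.CommonRing.rdivp A f); rewrite {1}defA r0 addr0.
have szQ (g : {poly int}) : size (map_poly (intr : int -> rat) g) = size g.
  by apply: size_map_inj_poly => //; apply: intr_inj.
have /irreducible_rat_int[_ irrQ] := f_irr.
have co : coprimep (map_poly (intr : int -> rat) f) (map_poly intr r).
  apply/negPn/negP => nco.
  have /eqp_dvdl := irrQ _ nco (dvdp_gcdl _ _).
  move/(_ (map_poly intr r)); rewrite dvdp_gcdr => /esym /dvdp_leq.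
  rewrite !szQ -size_poly_eq0 szQ size_poly_eq0 => /(_ r_neq0).
  by rewrite leqNgt Pdiv.CommonRing.ltn_rmodpN0 ?monic_neq0.
move: co; rewrite -(coprimep_map (in_alg K)) -!map_poly_intr_alg => /coprimep_root.
by move/(_ z); rewrite /root -!zevalE fz0 rz0 eqxx => /(_ isT).
Qed.

Lemma zeval_surj_frac (K : fieldExtType rat) (z x : K) :
    <<1; z>>%VS = fullv ->
  exists A : {poly int}, exists2 N : nat, (0 < N)%N & N%:R * x = zeval z A.
Proof.
move=> Kz; have xin : x \in <<1; z>>%VS by rewrite Kz memvf.
have /polyOver1P[p defp] := Fadjoin_polyOver 1%VS z x.
have [A [N N_neq0 defA]] := rat_poly_scale p.
(* [rat_poly_scale] gives a nonzero integer N of either sign; the sign moves to the numerator. *)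
exists ((sgz N)%:P * A), `|N|%N; first by rewrite absz_gt0.
rewrite rmorphM [zeval z _%:P]zevalC -[`|N|%:R]/(`|N|%N%:Z%:~R) abszEsg intrM -mulrA.
congr (_ * _); rewrite -(Fadjoin_poly_eq xin) defp defA.
rewrite map_polyZ hornerZ -map_poly_intr_alg -zevalE fmorphV rmorph_int mulrA.
by rewrite divff ?mul1r // intr_ext_eq0.
Qed.

(** * The pure fields Q(z) with z^d = 2p *)

Lemma irreducible_XnsubC_2p (d p : nat) :
  (1 < d)%N -> odd p -> irreducible_poly ('X^d - (2 * p)%:Z%:P : {poly int}).
Proof.
move=> d_gt1 p_odd; have d_gt0 := ltnW d_gt1.
apply: (@eisenstein_crit 2) => //.
- by rewrite size_XnsubC // eqSS -lt0n.
- by rewrite lead_coefXnsubC.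
- rewrite coefB coefXn coefC (ltn_eqF d_gt0) /= sub0r rpredN /=.
  by rewrite dvdzE /= (@dvdn_pmul2l 2 2 p) // dvdn2 p_odd.
- rewrite size_XnsubC //= => i lt_id; rewrite coefB coefXn coefC (ltn_eqF lt_id).
  by rewrite sub0r dvdzE abszN; case: eqP; rewrite //= dvdn_mulr.
Qed.

Lemma pure_field_exists (d p : nat) : (1 < d)%N -> odd p ->
  exists K : fieldExtType rat, \dim {: K} = d /\
    exists2 z : K, z ^+ d = (2 * p)%:R & <<1; z>>%VS = fullv.
Proof.
move=> d_gt1 p_odd; have d_gt0 := ltnW d_gt1.
have /irreducible_rat_int irrf := irreducible_XnsubC_2p d_gt1 p_odd.
have [K dimK [z fz0 Kz]] := irredp_FAdjoin irrf.
exists K; split.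
  rewrite dimK size_map_inj_poly ?size_XnsubC //; exact: intr_inj.
exists z => //; apply/eqP; rewrite -subr_eq0; move: fz0.
rewrite -map_poly_intr_alg /root -zevalE rmorphB rmorphXn.
by rewrite [zeval z _]zevalX [zeval z _]zevalC.
Qed.

(** * The residue map at 2 *)

Definition residue2 : {rmorphism {poly int} -> 'F_2} := intr \o horner_eval 0.
Arguments residue2 : simpl never.

Lemma residue2C (c : int) : residue2 c%:P = c%:~R.
Proof. by congr _%:~R; apply: hornerC. Qed.

Lemma residue2Cn (n : nat) : residue2 n%:Z%:P = n%:R.
Proof. exact: residue2C. Qed.

Lemma residue2X : residue2 'X = 0.
Proof. by rewrite /residue2 /= /horner_eval hornerX. Qed.

Section TotallyRamifiedAtTwo.

Variables (K : fieldExtType rat) (z : K) (d p : nat).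
Hypotheses (d_gt1 : (1 < d)%N) (p_odd : odd p) (zd : z ^+ d = (2 * p)%:R).
Hypothesis Kz : <<1; z>>%VS = fullv.

Let d_gt0 : (0 < d)%N := ltnW d_gt1.

Lemma zeval_XnsubC : zeval z ('X^d - (2 * p)%:Z%:P) = 0.
Proof.
by rewrite rmorphB rmorphXn [zeval z 'X]zevalX [zeval z _]zevalC zd subrr.
Qed.

(** [residue2] kills X^d - 2p, which generates the kernel of evaluation at z. It therefore induces a
    well-defined ring map from Z[z] to F_2. *)
Lemma residue2_zeval0 (A : {poly int}) : zeval z A = 0 -> residue2 A = 0.
Proof.
have [f_mon f_irr] := (monicXnsubC (2 * p)%:Z d_gt0, irreducible_XnsubC_2p d_gt1 p_odd).
move=> /(zeval_eq0_dvd f_mon f_irr zeval_XnsubC)[Q ->].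
rewrite rmorphM rmorphB rmorphXn [residue2 'X]residue2X [residue2 _%:P]residue2C.
rewrite expr0n (gtn_eqF d_gt0) PoszM intrM.
by rewrite [2%:Z%:~R](pchar_Fp_0 (isT : prime 2)) mul0r subr0 mulr0.
Qed.

Lemma pure_root_neq0 : z != 0.
Proof.
apply/negP => /eqP z0; move: zd; rewrite z0 expr0n (gtn_eqF d_gt0).
move/esym/eqP; rewrite -[_%:R]/((2 * p)%:Z%:~R) intr_ext_eq0.
by rewrite eqz_nat muln_eq0 /=; case: p p_odd.
Qed.

(** Z[z] localised at 2 is integrally closed. The power of 2 in a denominator is first traded for a
    power of z, and [claim] then removes the factors z one by one, at the cost of odd factors p. *)
Lemma integral_odd_denominator (x : K) : ring_of_integers x ->
  exists A : {poly int}, exists2 N : nat, odd N & N%:R * x = zeval z A.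
Proof.
move=> [P P_mon Px0].
suff claim m : (exists A : {poly int}, exists2 N : nat,
    odd N & z ^+ m * N%:R * x = zeval z A) ->
    exists A : {poly int}, exists2 N : nat, odd N & N%:R * x = zeval z A.
  have [A [N N_gt0 NxA]] := zeval_surj_frac x Kz.
  have [M coM defN] := pfactor_coprime (isT : prime 2) N_gt0.
  (* With N = M 2^v, M odd, the relation z^(dv) = (2p)^v gives z^(dv) M x = p^v N x. *)
  apply: (claim (d * logn 2 N)%N); exists ((p ^ logn 2 N)%:Z%:P * A), M.
    by rewrite -coprime2n.
  rewrite rmorphM [zeval z _%:P]zevalC -NxA {3}defN exprM zd.
  by rewrite -natrX expnMn !natrM !mulrA; ring.
(* In the step from m + 1 to m, reducing the integral equation of z^(m+1) N x
   modulo z shows that A(0) is even; since 2p = z^d, a factor z can then be cancelled. *)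
elim: m => [|m IHm] [A [N N_odd zNx]].
  by exists A, N => //; rewrite -zNx expr0 mul1r.
have A_even : residue2 A = 0.
  set n := (size P).-1.
  (* G(z) is (z^(m+1) N)^n P(x) = 0, while G is A^n mod X. *)
  pose G := \sum_(i < n.+1) (P`_i)%:P * A ^+ i * ('X ^+ m.+1 * N%:Z%:P) ^+ (n - i).
  have Gz : zeval z G = (z ^+ m.+1 * N%:R) ^+ n * (map_poly intr P).[x].
    have szP : size P = n.+1 by rewrite prednK // size_poly_gt0 monic_neq0.
    rewrite (@horner_coef_wide _ n.+1) -?szP ?size_poly // szP mulr_sumr rmorph_sum.
    apply: eq_bigr => i _; rewrite coef_map !rmorphM !rmorphXn rmorphM rmorphXn.
    rewrite ![zeval z _%:P]zevalC [zeval z 'X]zevalX -zNx.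
    have le_in : (i <= n)%N by rewrite -ltnS.
    rewrite -[N%:~R]/(N%:R) exprMn; set w := z ^+ m.+1 * _.
    have -> : w ^+ n = w ^+ i * w ^+ (n - i) by rewrite -exprD subnKC.
    by rewrite /=; ring.
  have /residue2_zeval0 : zeval z G = 0 by rewrite Gz (rootP Px0) mulr0.
  rewrite rmorph_sum big_ord_recr big1 ?Monoid.mul1m => [|i _]; last first.
    rewrite !rmorphM !rmorphXn rmorphM rmorphXn [residue2 'X]residue2X expr0n mul0r.
    by rewrite expr0n subn_eq0 leqNgt /= ltn_ord mulr0.
  rewrite !rmorphM !rmorphXn subnn expr0 mulr1 [residue2 _]residue2C.
  rewrite -lead_coefE (monicP P_mon) mul1r => /eqP.
  by rewrite expf_eq0 => /andP[_ /eqP].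
elim/poly_ind: A A_even zNx => [|B c _] A_even zNx.
  apply: IHm; exists 0, N => //; apply: (mulfI pure_root_neq0).
  by rewrite !mulrA -exprS zNx rmorph0 mulr0.
move: A_even; rewrite rmorphD rmorphM [residue2 'X]residue2X mulr0 add0r.
rewrite [residue2 _]residue2C => /eqP.
rewrite -(dvdz_pcharf (pchar_Fp (isT : prime 2))) => /dvdzP[c' defc].
(* Here A = B X + c with c = 2c'. As p c = 2p c' = z^d c', one has p A(z) = z (c' z^(d-1) + p
   B(z)). *)
apply: IHm; exists (c'%:P * 'X ^+ d.-1 + p%:Z%:P * B), (p * N)%N.
  by rewrite oddM p_odd.
apply: (mulfI pure_root_neq0).
have -> : z * (z ^+ m * (p * N)%:R * x) = p%:R * (z ^+ m.+1 * N%:R * x).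
  by rewrite natrM exprS; ring.
rewrite zNx !rmorphD !rmorphM rmorphXn ![zeval z _%:P]zevalC [zeval z 'X]zevalX.
rewrite [z * _]mulrDr [z * (_ * z ^+ _)]mulrCA -exprS prednK // zd defc.
by rewrite intrM natrM -[p%:~R]/(p%:R) -[2%:~R]/(2%:R); ring.
Qed.

End TotallyRamifiedAtTwo.

(** * Units and their sums modulo 2 *)

Lemma natr_F2 (n : nat) : n%:R = (odd n)%:R :> 'F_2.
Proof.
by rewrite -[in LHS](odd_double_half n) natrD -mul2n natrM pchar_Fp_0 // mul0r addr0.
Qed.

Lemma F2_neq0_eq1 (a : 'F_2) : a != 0 -> a = 1.
Proof. by case: a => [[|[|m]] //= lt_m2] _; apply: val_inj. Qed.

Section UnitSums.

Variables (K : fieldExtType rat) (z : K) (d p : nat).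
Hypotheses (d_gt1 : (1 < d)%N) (p_odd : odd p) (zd : z ^+ d = (2 * p)%:R).
Hypothesis Kz : <<1; z>>%VS = fullv.

(** If x = A(z)/N has inverse B(z)/M, then A B - N M vanishes at z, so the residues of A and B
    multiply to the residue 1 of the odd number N M. *)
Lemma unit_residue (x : K) : integer_unit x ->
  exists A : {poly int}, exists N : nat,
    [/\ odd N, N%:R * x = zeval z A & residue2 A = 1].
Proof.
move=> [x_int [y y_int xy1]].
have [A [N N_odd NxA]] := integral_odd_denominator d_gt1 p_odd zd Kz x_int.
have [B [M M_odd MyB]] := integral_odd_denominator d_gt1 p_odd zd Kz y_int.
exists A, N; split=> //; apply: F2_neq0_eq1; apply/eqP => A0.
have /(residue2_zeval0 d_gt1 p_odd zd) : zeval z (A * B - (N * M)%N%:Z%:P) = 0.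
  rewrite rmorphB rmorphM [zeval z _%:P]zevalCn -NxA -MyB mulrACA xy1 mulr1.
  by rewrite natrM subrr.
rewrite rmorphB rmorphM A0 mul0r sub0r [residue2 _]residue2Cn.
by rewrite natr_F2 oddM N_odd M_odd => /eqP; rewrite oppr_eq0 oner_eq0.
Qed.

(** Odd denominators are 1 in F_2, so passing to a common denominator leaves the residues of the
    numerators unchanged, and they add up. *)
Lemma unit_sum_residue (k : nat) (e : 'I_k -> K) : (forall i, integer_unit (e i)) ->
  exists A : {poly int}, exists N : nat,
    [/\ odd N, N%:R * (\sum_(i < k) e i) = zeval z A & residue2 A = k%:R].
Proof.
elim: k e => [|k IHk] e e_unit.
  by exists 0, 1%N; split; rewrite ?big_ord0 ?mulr0 ?rmorph0.
have [|A [N [N_odd NA A1]]] := IHk (e \o widen_ord (leqnSn k)).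
  by move=> i; apply: e_unit.
have [B [M [M_odd MB B1]]] := unit_residue (e_unit ord_max).
exists (M%:Z%:P * A + N%:Z%:P * B), (N * M)%N; split; first by rewrite oddM N_odd.
  rewrite big_ord_recr natrM mulrDr rmorphD !rmorphM ![zeval z _%:P]zevalCn -NA -MB.
  by ring.
rewrite rmorphD !rmorphM ![residue2 _%:P]residue2Cn A1 B1.
rewrite [M%:R]natr_F2 [N%:R]natr_F2 M_odd N_odd.
by rewrite !mul1r mulrS addrC.
Qed.

Lemma od_pure_field : od K = None.
Proof.
rewrite /od; case: pselect => // ex_k; exfalso.
case: ex_k => k [k_odd _ [e [e_unit e0]]].
have [A [N [_ NA Ak]]] := unit_sum_residue e_unit.
have := residue2_zeval0 d_gt1 p_odd zd (A := A).
rewrite -NA e0 mulr0 Ak natr_F2 k_odd => /(_ erefl) /eqP.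
by rewrite oner_eq0.
Qed.

End UnitSums.

(** * Reduction modulo an unramified prime p, and d-th roots of 2p *)

Lemma separable_dvdp_exp (F : fieldType) (f g : {poly F}) (n : nat) :
  separable_poly f -> f %| g ^+ n -> f %| g.
Proof.
(* In f = k gcd(f, g), separability makes k coprime to the gcd, hence to g because k divides f. As k
   also divides g^n, it is constant. *)
move=> f_sep f_dvd; have [k defk] := dvdpP _ _ (dvdp_gcdl f g).
move: f_sep; rewrite {1}defk separable_mul => /and3P[_ _ co_k].
have co_kg : coprimep k g.
  have k_dvd : k %| f by rewrite [X in _ %| X]defk dvdp_mulr.
  rewrite /coprimep -dvdp1 -(eqp_dvdr _ (_ : gcdp k (gcdp f g) %= 1)); last first.
    by rewrite -size_poly_eq1.
  by rewrite !dvdp_gcd dvdp_gcdl dvdp_gcdr (dvdp_trans (dvdp_gcdl _ _) k_dvd).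
have k_dvd : k %| g ^+ n.
  by apply: dvdp_trans f_dvd; rewrite [X in _ %| X]defk dvdp_mulr.
have k1 : k %= 1.
  rewrite -size_poly_eq1 -(coprimepp k).
  exact: coprimep_dvdl k_dvd (coprimep_expr n co_kg).
rewrite [X in X %| _]defk (eqp_dvdl _ (eqp_mulr _ k1)) mul1r; exact: dvdp_gcdr.
Qed.

(** The derivative d X^(d-1) can vanish only at 0, which is not a root of X^d - a. *)
Lemma separable_XnsubC (F : fieldType) (d : nat) (a : F) :
  d%:R != 0 :> F -> a != 0 -> separable_poly ('X^d - a%:P).
Proof.
move=> d_neq0 a_neq0.
rewrite separable_poly.unlock derivB derivXn derivC subr0 -scaler_nat coprimepZr //.
have d_gt0 : (0 < d)%N by case: (d) d_neq0 => //; rewrite eqxx.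
apply: coprimep_expr; rewrite coprimepX /root !hornerE expr0n (gtn_eqF d_gt0).
by rewrite sub0r oppr_eq0.
Qed.

Lemma map_poly_intr_Fp_surj (p : nat) (h : {poly 'F_p}) :
  exists B : {poly int}, map_poly intr B = h.
Proof.
exists (map_poly (fun c : 'F_p => (val c)%:Z) h); apply/polyP => i.
by rewrite coef_map coef_map_id0 //=; apply: natr_Zp.
Qed.

Lemma map_poly_intr_Fp_eq0 (p : nat) (A : {poly int}) : prime p ->
  map_poly (intr : int -> 'F_p) A = 0 -> exists B, A = p%:Z *: B.
Proof.
move=> p_pr /polyP A0; exists (map_poly (fun c => (c %/ p)%Z) A); apply/polyP => i.
rewrite coefZ coef_map_id0 ?div0z // mulrC divzK //.
by rewrite (dvdz_pcharf (pchar_Fp p_pr)); have := A0 i; rewrite coef_map coef0 => ->.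
Qed.

(** Write g = A(z)/N. The ring F_p[X]/(X^d - 2q) is reduced, so A(z)^d = 2p N^d forces A(z) into p
    Z[z]. Comparing powers of p then yields a factor p of N, and cancelling it can be repeated
    forever. *)
Lemma no_pure_root (K : fieldExtType rat) (z g : K) (d p q : nat) :
    (1 < d)%N -> odd q -> z ^+ d = (2 * q)%:R -> <<1; z>>%VS = fullv ->
    prime p -> ~~ (p %| d)%N -> ~~ (p %| 2 * q)%N ->
  g ^+ d <> (2 * p)%:R.
Proof.
move=> d_gt1 q_odd zd Kz p_pr p_d p_q gd; have d_gt0 := ltnW d_gt1.
set f : {poly int} := 'X^d - (2 * q)%:Z%:P.
have chF := pchar_Fp p_pr.
pose red : {rmorphism {poly int} -> {poly 'F_p}} := map_poly intr.
have redC (c : int) : red c%:P = c%:~R%:P by apply: map_polyC.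
have redCn (n : nat) : red n%:Z%:P = n%:R%:P by apply: redC.
have redC0 (n : nat) : (p %| n)%N -> red n%:Z%:P = 0.
  by rewrite (dvdn_pcharf chF) redCn => /eqP ->.
have redf : red f = 'X^d - (2 * q)%:R%:P.
  by rewrite rmorphB redC; congr (_ - _); apply: map_polyXn.
have f_sep : separable_poly (red f).
  by rewrite redf; apply: separable_XnsubC; rewrite -(dvdn_pcharf chF).
(* X^d - 2q generates the kernel of evaluation at z, so relations in Z[z] become divisibilities over
   F_p. *)
have vanish A : zeval z A = 0 -> red f %| red A.
  move=> Az0; have f_irr := irreducible_XnsubC_2p d_gt1 q_odd.
  have [Q ->] := zeval_eq0_dvd (monicXnsubC _ d_gt0) f_irr (zeval_XnsubC zd) Az0.
  by rewrite rmorphM dvdp_mulIr.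
have [A [N N_gt0 NgA]] := zeval_surj_frac g Kz.
(* Descent on the denominator N of g: p divides A modulo X^d - 2q, and then N. *)
elim/ltn_ind: N A N_gt0 NgA => N IHN A N_gt0 NgA.
have f_dvdA : red f %| red A.
  apply: (@separable_dvdp_exp _ _ _ d) => //.
  have := vanish (A ^+ d - (N ^ d * (2 * p))%:Z%:P).
  rewrite rmorphB rmorphXn [zeval z _%:P]zevalCn -NgA exprMn gd.
  rewrite -natrX -natrM subrr => /(_ erefl).
  rewrite [red (A ^+ d - _)]rmorphB rmorphXn.
  by rewrite (redC0 (N ^ d * (2 * p))%N) ?subr0 // !dvdn_mull.
have [h defh] := dvdpP _ _ f_dvdA.
have [C defC] := map_poly_intr_Fp_surj h.
have [B defB] : exists B, A - C * f = p%:Z *: B.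
  apply: map_poly_intr_Fp_eq0 => //.
  by rewrite -[map_poly _ _]/(red _) rmorphB rmorphM defh -defC subrr.
have NgB : N%:R * g = p%:R * zeval z B.
  have /(congr1 (zeval z)) := defB.
  rewrite rmorphB rmorphM (zeval_XnsubC zd) mulr0 subr0 -NgA.
  by rewrite -mul_polyC rmorphM zevalCn.
have p_neq0 : p%:R != 0 :> K.
  by rewrite pmulrn intr_ext_eq0 eqz_nat -lt0n prime_gt0.
have p_dvdN : (p %| N)%N.
  (* Cancelling one p in p^d B(z)^d = 2p N^d leaves p^(d-1) B(z)^d = 2 N^d. As d > 1, modulo p the
     polynomial [red f], of positive degree, divides the constant 2 N^d, which is thus 0 in F_p. *)
  have := vanish ((p ^ d.-1)%:Z%:P * B ^+ d - (2 * N ^ d)%:Z%:P).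
  rewrite rmorphB rmorphM [zeval z (B ^+ d)]rmorphXn ![zeval z _%:P]zevalCn.
  have -> : (p ^ d.-1)%:R * zeval z B ^+ d - (2 * N ^ d)%:R = 0.
    apply: (mulfI p_neq0); rewrite mulr0 mulrBr mulrA -natrM -expnS prednK //.
    rewrite natrX -exprMn -NgB exprMn gd -natrX -!natrM [(N ^ d * _)%N]mulnC.
    by rewrite [(2 * p)%N]mulnC -mulnA subrr.
  move=> /(_ erefl); rewrite [red (_ * _ - _)]rmorphB [red (_ * _)]rmorphM.
  rewrite (redC0 (p ^ d.-1)%N); last first.
    by apply: dvdn_exp; rewrite // -subn1 subn_gt0.
  rewrite mul0r sub0r dvdpNr (redCn (2 * N ^ d)%N).
  move=> /dvdp_leq; rewrite redf size_XnsubC // size_polyC polyC_eq0.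
  rewrite -(dvdn_pcharf chF); case: (boolP (p %| 2 * N ^ d)%N) => [|_ /(_ isT)].
    have p_2 : (p %| 2)%N = false by apply: contraNF p_q => /dvdn_mulr; apply.
    by rewrite Euclid_dvdM // Euclid_dvdX // p_2 d_gt0 andbT.
  by rewrite ltnS leqn0; move: d_gt1; case: (d).
have [N' defN] := dvdnP p_dvdN.
apply: (IHN N' _ B).
- by rewrite defN ltn_Pmulr ?prime_gt1 //; case: N' defN N_gt0 => // ->.
- by case: N' defN N_gt0 => // ->.
by apply: (mulfI p_neq0); rewrite -NgB defN natrM; ring.
Qed.

Theorem theorem5 (d : nat) (hd : (2 <= d)%N) :
  exists K : nat -> fieldExtType rat,
    (forall n, \dim {: K n} = d /\ od (K n) = None) /\
    (forall m n, m <> n -> ~ field_isomorphic (K m) (K n)).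
Proof.
pose next m := s2val (prime_above m).
have next_gt m : (m < next m)%N by exact: s2valP (prime_above m).
have next_prime m : prime (next m) by exact: s2valP' (prime_above m).
(* Starting above d makes every p n an odd prime not dividing d; [n.+1] steps ensure this already
   for p 0. *)
pose p n := iter n.+1 next d.
have p_prime n : prime (p n) by apply: next_prime.
have p_gtd n : (d < p n)%N by elim: n => [|n /ltn_trans]; last apply; apply: next_gt.
have p_odd n : odd (p n) by case: (even_prime (p_prime n)) (p_gtd n) hd => // ->; lia.
have p_mono m n : (m < n)%N -> (p m < p n)%N.
  by apply: (homo_ltn ltn_trans) => k; apply: next_gt.
have [K HK] := choice (fun n => pure_field_exists hd (p_odd n)).
exists K; split=> [n|m n mn [f _]].
  have [dimK [z zd Kz]] := HK n; split=> //.
  exact: od_pure_field hd (p_odd n) zd Kz.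
have [_ [y yd _]] := HK m; have [_ [z zd Kz]] := HK n.
have p_ndvd k : (0 < k < p m)%N -> ~~ (p m %| k)%N.
  by case/andP=> k_gt0 lt_k; rewrite gtnNdvd.
(* An isomorphism would carry the generator y of [K m] to a d-th root of 2 (p m) in [K n]. *)
apply: (no_pure_root (g := f y) hd (p_odd n) zd Kz (p_prime m)).
- by rewrite p_ndvd // p_gtd ltnW.
- rewrite Euclid_dvdM // negb_or p_ndvd ?(leq_ltn_trans hd) //.
  rewrite dvdn_prime2 //; apply/eqP => pmn.
  by case: (ltngtP m n) mn => // /p_mono; rewrite pmn ltnn.
by rewrite -rmorphXn yd rmorph_nat.
Qed.
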